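(* The following classes of groups are self-integrating: (1) finite groups; (2) finitely generated groups; (3) polycyclic groups, and more generally groups satisfying Max; (4) finitely generated, residually finite groups.
   Context: For a group $H$, $H'$ denotes the derived group (commutator subgroup). An integral of a group $G$ is a group $H$ such that $H'\cong G$; $G$ is integrable if it has an integral. A class $\mathcal{C}$ of groups (closed under isomorphism) is self-integrating if, whenever $G$ is an integrable group in $\mathcal{C}$, then $G$ has an integral in $\mathcal{C}$. A group satisfies Max if it satisfies the maximal condition on subgroups (equivalently, every subgroup is finitely generated). Item (3) asserts both that the class of polycyclic groups is self-integrating and that the class of groups satisfying Max is self-integrating. *)

(* Defs.v *)
From HB Require Import structures.
From mathcomp Require Import all_boot ssralg ssrint.
From mathcomp Require Import boolp classical_sets functions cardinality.
Set Implicit Arguments.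
Unset Strict Implicit.
Unset Printing Implicit Defensive.

Local Open Scope classical_set_scope.
Local Open Scope group_scope.

(* Groups, possibly infinite, are MathComp's [groupType]; its choice operator
   costs no generality, since the axioms of [boolp] provide one on any type.
   Subgroups of G are elements of [set G]. *)

Section Subgroups.
Variable G : groupType.
Implicit Types (A K N : set G) (x : G).

Definition is_subgroup K : Prop := group_closed [in K].

Definition generated A : set G := smallest is_subgroup A.

Definition derived : set G := generated [set [~ p.1, p.2] | p in [set: G * G]].

Definition is_normal N K : Prop :=
  [/\ is_subgroup N, is_subgroup K, N `<=` K &
      forall x y, N x -> K y -> N (x ^ y)].

Definition expgz x (m : int) : G :=
  match m with Posz n => x ^+ n | Negz n => x ^- n.+1 end.

Definition left_coset x N : set G := [set x * y | y in N].

(* K / N is cyclic: some coset g N has every coset of N in K among its powers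
   (g N)^m = g^m N; meant for N normal in K. *)
Definition cyclic_quotient K N : Prop :=
  exists2 g, K g &
    forall x, K x -> exists m : int, left_coset x N = left_coset (expgz g m) N.

End Subgroups.
Arguments derived G : clear implicits.

Definition isomorphic_to_subgroup (G H : groupType) (K : set H) : Prop :=
  exists f : {multiplicative G -> H}, set_bij [set: G] K f.

Definition integral (G H : groupType) : Prop :=
  isomorphic_to_subgroup G (derived H).

Definition integrable (G : groupType) : Prop :=
  exists H : groupType, integral G H.

Definition self_integrating (C : groupType -> Prop) : Prop :=
  forall G : groupType, C G -> integrable G ->
    exists2 H : groupType, C H & integral G H.

Definition finite_group (G : groupType) : Prop := finite_set [set: G].

Definition finitely_generated (G : groupType) : Prop :=
  exists2 A : set G, finite_set A & generated A = [set: G].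

Definition polycyclic (G : groupType) : Prop :=
  exists (n : nat) (K : nat -> set G),
    [/\ K 0%N = [set 1], K n = [set: G] &
        forall i, (i < n)%N ->
          is_normal (K i) (K i.+1) /\ cyclic_quotient (K i.+1) (K i)].

(* The maximal condition on subgroups: every nonempty family of subgroups has
   a maximal member. *)
Definition satisfies_Max (G : groupType) : Prop :=
  forall F : set (set G), F `<=` @is_subgroup G -> F !=set0 ->
    exists2 M, F M & forall K, F K -> M `<=` K -> K = M.

Definition residually_finite (G : groupType) : Prop :=
  forall g : G, g <> 1 ->
    exists (Q : groupType) (f : {multiplicative G -> Q}),
      finite_group Q /\ f g <> 1.

(* Main.v *)
From HB Require Import structures.
Require Import Defs.
From mathcomp Require Import all_boot.
From mathcomp Require Import ssralg ssrint.
From mathcomp Require Import generic_quotient.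
From mathcomp Require Import boolp classical_sets cardinality.

(** Let f be an isomorphism from G onto the derived group H' of some group H.

    Finitely generated groups.  Each generator of H' is a product of
    commutators, hence lies in the derived group of a finitely generated
    subgroup of H.  As finitely many generators suffice, H' = B' for one
    finitely generated subgroup B of H ([fg_integral]).  The groups in all the
    classes are finitely generated, so in each of the other parts H itself may
    be assumed to be finitely generated.

    Max and polycyclic groups.  The quotient H / H' is abelian, so adding the
    generators of H to H' one after the other gives a chain of normal subgroups
    from H' to H with cyclic quotients ([derived_ind]).  Both properties pass
    from H' to H along such a chain ([max_on_cyclic_extension],
    [polycyclic_on_cyclic_extension]).

    Finite groups.  Suppose that H' is finite.  Commutators with powers of an
    element take finitely many values, so some positive power of every element
    is central ([central_power]).  Adding such powers of the generators,
    whenever they have infinite order modulo what was added before, gives a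
    central subgroup N that meets H' trivially and contains a positive power of
    each generator ([central_complement]).  Then H / N is generated by torsion
    elements and has a finite derived group, so that it is finite, and H' embeds
    in it ([finite_quotient_of_finite_derived]).

    Residually finite groups.  Let R be the intersection of the kernels of all
    homomorphisms from H to finite groups.  Then H / R is residually finite, and
    its derived group is H' provided that R meets H' trivially.  Given g <> 1
    in H', choose a homomorphism from H' to a finite group Q that does not kill
    g, and let K be the intersection of the kernels of all homomorphisms from
    H' to Q.  It is characteristic in H', hence normal in H, and it has finite
    index in H', since there are only finitely many homomorphisms from a
    finitely generated group to Q.  Thus H / K has a finite derived group, and
    the previous part gives a finite quotient of H / K, hence of H, in which g
    survives ([derived_finite_residual]). *)

Set Implicit Arguments.
Unset Strict Implicit.
Unset Printing Implicit Defensive.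

Local Open Scope classical_set_scope.
Local Open Scope group_scope.

(** * Subgroups and generation *)

Section Subgroups.
Variable G : groupType.
Implicit Types (A K N : set G) (x y : G).

Lemma is_subgroupP K :
  is_subgroup K <-> K 1 /\ forall x y, K x -> K y -> K (x / y).
Proof.
split=> [[K1 KF]|[K1 KF]]; split.
- by move: K1; rewrite inE.
- by move=> x y Kx Ky; have := KF x y; rewrite !inE; apply.
- by rewrite inE.
- by move=> x y; rewrite !inE; apply: KF.
Qed.

Section Closure.
Variables (K : set G) (sK : is_subgroup K).

Lemma subgroup1 : K 1.
Proof. by have /is_subgroupP[] := sK. Qed.

Lemma subgroupF x y : K x -> K y -> K (x / y).
Proof. by have /is_subgroupP[_] := sK; apply. Qed.

Lemma subgroupV x : K x -> K x^-1.
Proof. by rewrite -[x^-1]mul1g; apply: subgroupF; apply: subgroup1. Qed.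

Lemma subgroupM x y : K x -> K y -> K (x * y).
Proof. by move=> Kx Ky; rewrite -[y]invgK; apply/subgroupF/subgroupV. Qed.

Lemma subgroupX x n : K x -> K (x ^+ n).
Proof.
move=> Kx; elim: n => [|n IHn]; first exact: subgroup1.
by rewrite expgS; apply: subgroupM.
Qed.

Lemma subgroup_expgz x m : K x -> K (expgz x m).
Proof.
by case: m => n Kx; [apply: subgroupX | apply/subgroupV/subgroupX].
Qed.

End Closure.

Lemma is_subgroupT : is_subgroup [set: G].
Proof. by apply/is_subgroupP. Qed.

Lemma is_subgroup1 : is_subgroup [set 1 : G].
Proof.
by apply/is_subgroupP; split=> // _ _ -> ->; rewrite invg1 mulg1.
Qed.

Lemma is_subgroup_centralizer x : is_subgroup [set y | commute x y].
Proof.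
apply/is_subgroupP; split=> [|y z]; first exact: commute1.
by move=> xy xz; apply/commuteM/commuteV.
Qed.

Lemma is_subgroup_generated A : is_subgroup (generated A).
Proof.
apply/is_subgroupP; split=> [K [sK _]|x y Ax Ay K KA]; first exact: subgroup1.
by have [sK _] := KA; apply: subgroupF => //; [apply: Ax | apply: Ay].
Qed.

Lemma sub_generated A : A `<=` generated A.
Proof. exact: sub_gen_smallest. Qed.

Lemma generated_sub A K : is_subgroup K -> A `<=` K -> generated A `<=` K.
Proof. exact: smallest_sub. Qed.

Lemma generatedS A B : A `<=` B -> generated A `<=` generated B.
Proof.
by move=> AB; apply: sub_smallest2r => //; apply: is_subgroup_generated.
Qed.

Definition commutators K : set G := [set [~ p.1, p.2] | p in K `*` K].

Lemma commutatorsS K L : K `<=` L -> commutators K `<=` commutators L.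
Proof.
by move=> KL _ [p [Kp1 Kp2] <-]; exists p => //; split; apply: KL.
Qed.

Lemma derivedE : derived G = generated (commutators [set: G]).
Proof. by rewrite /commutators setXTT. Qed.

Lemma is_subgroup_derived : is_subgroup (derived G).
Proof. exact: is_subgroup_generated. Qed.

Lemma derivedR x y : derived G [~ x, y].
Proof. by apply: sub_generated; exists (x, y). Qed.

(** x ^ y and x differ by a commutator. *)
Lemma normal_derived_sub K :
  is_subgroup K -> derived G `<=` K -> is_normal K [set: G].
Proof.
move=> sK dK; split=> // [|x y Kx _]; first exact: is_subgroupT.
rewrite -(mulVKg x (x ^ y)) -commgEl; apply: subgroupM => //.
by apply: dK; apply: derivedR.
Qed.

Lemma normal_derived : is_normal (derived G) [set: G].
Proof. exact: normal_derived_sub is_subgroup_derived _. Qed.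

(** * Integer powers and cyclic extensions *)

(** Writing integers as differences of naturals turns the sign analysis in the
    exponent law below into commutation of powers of x. *)
Lemma expgzBn x (m n : nat) : expgz x (m%:Z - n%:Z)%R = x ^+ m / x ^+ n.
Proof.
have [le_nm|lt_mn] := leqP n m; first by rewrite subzn // -expgnFr.
rewrite -GRing.opprB subzn 1?ltnW //; have := subn_gt0 m n; rewrite lt_mn.
case E: (n - m)%N => [//|k] _; rewrite -NegzE /= -E -invgF; congr _^-1.
by rewrite expgnFr // ltnW.
Qed.

Lemma intBn (m : int) : exists p q : nat, m = (p%:Z - q%:Z)%R.
Proof.
by case: m => n; [exists n, 0%N; rewrite GRing.subr0|
                  exists 0%N, n.+1; rewrite GRing.sub0r NegzE].
Qed.

Lemma expgzD x (m n : int) : expgz x (m + n)%R = expgz x m * expgz x n.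
Proof.
have [[p [q ->]] [r [t ->]]] := (intBn m, intBn n).
rewrite GRing.addrACA -GRing.opprD -!PoszD !expgzBn !expgnDr invgM.
have C : commute (x ^+ r) (x ^- q) by apply/commuteV/commuteX2/commute_refl.
rewrite -!mulgA [x ^- q * _]mulgA -C -mulgA -!invgM -!expgnDr.
by rewrite [(t + q)%N]addnC.
Qed.

Lemma commute_expgz x y m : commute x y -> commute x (expgz y m).
Proof. exact: (subgroup_expgz (is_subgroup_centralizer x)). Qed.

Lemma expgzN x (m : int) : expgz x (- m)%R = (expgz x m)^-1.
Proof.
by apply: (mulgI (expgz x m)); rewrite mulgV -expgzD GRing.subrr.
Qed.

(** When N is normal this is the subgroup generated by x and N. *)
Definition adjoin x N : set G :=
  [set expgz x m * y | m in [set: int] & y in N].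

Section Adjoin.
Variables (g : G) (N : set G).
Hypothesis nN : is_normal N [set: G].

Let sN : is_subgroup N. Proof. by case: nN. Qed.

Lemma is_subgroup_adjoin : is_subgroup (adjoin g N).
Proof.
apply/is_subgroupP; split.
  by exists 0%R => //; exists 1; [exact: subgroup1 | rewrite mulg1].
move=> _ _ [m _ [y Ny <-]] [k _ [z Nz <-]].
exists (m - k)%R => //; exists ((y / z) ^ expgz g (- k)).
  by case: nN => _ _ _; apply=> //; apply: subgroupF.
by rewrite expgzD -mulgA -conjgC expgzN invgM !mulgA.
Qed.

Lemma sub_adjoin : N `<=` adjoin g N.
Proof. by move=> y Ny; exists 0%R => //; exists y => //; rewrite mul1g. Qed.

Lemma mem_adjoin : adjoin g N g.
Proof.
by exists 1%R => //; exists 1; [exact: subgroup1 | rewrite mulg1].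
Qed.

Lemma normal_in_adjoin : is_normal N (adjoin g N).
Proof.
split=> //; [exact: is_subgroup_adjoin | exact: sub_adjoin |].
by case: nN => _ _ _ NJ x y Nx _; apply: NJ.
Qed.

Lemma left_cosetMr x y : N y -> left_coset (x * y) N = left_coset x N.
Proof.
move=> Ny; apply/seteqP; split=> _ [z Nz <-].
  by exists (y * z); [exact: subgroupM | rewrite mulgA].
exists (y^-1 * z); first by apply: subgroupM => //; apply: subgroupV.
by rewrite mulgA mulgK.
Qed.

Lemma cyclic_quotient_adjoin : cyclic_quotient (adjoin g N) N.
Proof.
exists g; first exact: mem_adjoin.
by move=> _ [m _ [y Ny <-]]; exists m; apply: left_cosetMr.
Qed.

End Adjoin.

Lemma cyclic_quotientP K N : is_subgroup N -> cyclic_quotient K N ->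
  exists2 g, K g & K `<=` adjoin g N.
Proof.
move=> sN [g Kg gK]; exists g => // x /gK[m xm].
have : left_coset x N x by exists 1; [exact: subgroup1 | rewrite mulg1].
by rewrite xm => -[y Ny <-]; exists m => //; exists y.
Qed.

End Subgroups.
Arguments is_subgroupT {G}.
Arguments is_subgroup1 {G}.

(** * Homomorphisms *)

Lemma injective_image (T U : Type) (f : T -> U) (A B : set T) :
  injective f -> f @` A = f @` B -> A = B.
Proof.
by move=> fI AB; apply/seteqP; split=> x; rewrite -2!(image_inj fI) AB.
Qed.

Lemma multiplicativeP (G H : groupType) (f : G -> H) :
  {morph f : x y / x * y} -> exists g : {multiplicative G -> H}, g =1 f.
Proof.
move=> fM; pose m := isMultiplicative.Build G H f fM.
pose g : {multiplicative G -> H} := HB.pack f m.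
by exists g.
Qed.

Section Morphisms.
Variables (G H : groupType) (f : {multiplicative G -> H}).
Implicit Types (x y : G) (A K N : set G).

Lemma hom1 : f 1 = 1.
Proof. by apply: (mulgI (f 1)); rewrite -gmulfM !mulg1. Qed.

(** A map between groups that preserves products also preserves 1; as a unital
    morphism, f inherits the general theory of morphisms. *)
Definition umagma_hom : UMagmaMorphism.type G H :=
  let m1 := Multiplicative_isUMagmaMorphism.Build G H f hom1 in
  HB.pack (Multiplicative.sort f) m1.

Lemma homV x : f x^-1 = (f x)^-1.
Proof. exact: (@gmulfV G H umagma_hom). Qed.
Lemma homF x y : f (x / y) = f x / f y.
Proof. exact: (@gmulfF G H umagma_hom). Qed.
Lemma homJ x y : f (x ^ y) = f x ^ f y.
Proof. exact: (@gmulfJ G H umagma_hom). Qed.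
Lemma homR x y : f [~ x, y] = [~ f x, f y].
Proof. exact: (@gmulfR G H umagma_hom). Qed.
Lemma homX x n : f (x ^+ n) = f x ^+ n.
Proof. exact: (@gmulfXn G H umagma_hom n). Qed.
Lemma hom_expgz x m : f (expgz x m) = expgz (f x) m.
Proof. by case: m => n /=; rewrite ?homV homX. Qed.

Lemma hom_inj : (forall x, f x = 1 -> x = 1) -> injective f.
Proof. exact: (@gmulf_inj G H umagma_hom). Qed.

Lemma is_subgroup_image K : is_subgroup K -> is_subgroup (f @` K).
Proof.
move=> sK; apply/is_subgroupP; split.
  by exists 1; [exact: subgroup1 | exact: hom1].
move=> _ _ [x Kx <-] [y Ky <-]; exists (x / y); first exact: subgroupF.
by rewrite homF.
Qed.

Lemma is_subgroup_preimage (L : set H) :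
  is_subgroup L -> is_subgroup (f @^-1` L).
Proof.
move=> sL; apply/is_subgroupP; split.
  by rewrite /= hom1; apply: subgroup1.
by move=> x y Lx Ly /=; rewrite homF; apply: subgroupF.
Qed.

Lemma image_generated A : f @` generated A = generated (f @` A).
Proof.
apply/seteqP; split.
  apply/image_subP; apply: generated_sub.
    exact: is_subgroup_preimage (@is_subgroup_generated _ _).
  by move=> x Ax; apply: sub_generated; exists x.
apply: generated_sub.
  exact: is_subgroup_image (@is_subgroup_generated _ _).
by apply: image_subset; apply: sub_generated.
Qed.

Lemma image_derived : f @` derived G = generated (commutators (range f)).
Proof.
rewrite derivedE image_generated; congr generated.
apply/seteqP; split.
  by move=> _ [_ [[x y] _ <-] <-]; exists (f x, f y); rewrite ?homR.
move=> _ [[_ _] /= [[x _ <-] [y _ <-]] <-].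
by exists [~ x, y]; [exists (x, y) | rewrite homR].
Qed.

Lemma image_derived_surj : range f = [set: H] -> f @` derived G = derived H.
Proof. by move=> fT; rewrite image_derived fT derivedE. Qed.

Lemma fg_surj :
  range f = [set: H] -> finitely_generated G -> finitely_generated H.
Proof.
move=> fT [A finA AG]; exists (f @` A); first exact: finite_image.
by rewrite -image_generated AG.
Qed.

End Morphisms.

Lemma iso_subgroupP (G H : groupType) (K : set H) :
  isomorphic_to_subgroup G K <->
  exists f : {multiplicative G -> H}, injective f /\ range f = K.
Proof.
split=> -[f]; [case=> [fK fI fS] | case=> [fI fK]]; exists f; split.
- by move=> x y; apply: fI; rewrite inE.
- by apply/seteqP; split=> // _ [x _ <-]; apply: fK.
- by move=> x _; rewrite -fK; exists x.
- by move=> x y _ _; apply: fI.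
- by move=> x; rewrite -fK.
Qed.

Lemma factor_through_injection (G H L : groupType)
    (i : {multiplicative L -> H}) (f : {multiplicative G -> H}) :
  injective i -> range f `<=` range i ->
  exists g : {multiplicative G -> L}, forall x, i (g x) = f x.
Proof.
move=> iI fi; have /choice[g gE] x : exists y, i y = f x.
  by have [|y _ <-] := fi (f x); [exists x | exists y].
have [|g' g'E] := @multiplicativeP _ _ g.
  by move=> x y; apply: iI; rewrite gmulfM !gE gmulfM.
by exists g' => x; rewrite g'E.
Qed.

Lemma factor_through_surjection (G H L : groupType)
    (p : {multiplicative G -> H}) (f : {multiplicative G -> L}) :
  range p = [set: H] -> (forall x, p x = 1 -> f x = 1) ->
  exists g : {multiplicative H -> L}, forall x, g (p x) = f x.
Proof.
move=> pT kf; have pf x y : p x = p y -> f x = f y.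
  by move=> xy; apply/divg1_eq; rewrite -homF kf // homF xy mulgV.
have /choice[r rE] y : exists x, p x = y.
  by have [x _ xy] : range p y; [rewrite pT | exists x].
have [|g gE] := @multiplicativeP _ _ (f \o r).
  by move=> x y /=; rewrite -gmulfM; apply: pf; rewrite gmulfM !rE.
by exists g => x; rewrite gE /=; apply: pf; rewrite rE.
Qed.

(** * Subgroups and quotients as groups *)

Section SubgroupType.
Variables (G : groupType) (K : set G) (sK : is_subgroup K).

(** The proof [sK] occurs in the type so that the group structure can be
    recovered from it. *)
Definition subgroup_type := let _ := sK in {x : G | x \in K}.

HB.instance Definition _ :=
  [isSub of subgroup_type for @sval G (fun x => x \in K)].
HB.instance Definition _ := [Choice of subgroup_type by <:].
HB.instance Definition _ := SubChoice_isSubGroup.Build G _ subgroup_type sK.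

Lemma subgroup_inclusion :
  exists (H : groupType) (i : {multiplicative H -> G}),
    injective i /\ range i = K.
Proof.
exists subgroup_type, (val : {multiplicative subgroup_type -> G}).
split; first exact: val_inj.
apply/seteqP; split=> [_ [x _ <-]|x Kx]; first exact/set_mem/(valP x).
by exists (Sub x (mem_set Kx)); rewrite ?SubK.
Qed.
End SubgroupType.

Section QuotientType.
Variables (G : groupType) (N : set G) (nN : is_normal N [set: G]).
Let sN : is_subgroup N. Proof. by case: nN. Qed.
Let NJ x y : N x -> N (x ^ y).
Proof. by case: nN => _ _ _ NJ Nx; apply: NJ. Qed.

Definition coset_rel (x y : G) : bool := `[< N (x^-1 * y) >].

Lemma coset_rel_refl : reflexive coset_rel.
Proof. by move=> x; apply/asboolP; rewrite mulVg; apply: subgroup1. Qed.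

Lemma coset_rel_sym : symmetric coset_rel.
Proof.
by move=> x y; apply/asboolP/asboolP => /(subgroupV sN); rewrite invgM invgK.
Qed.

Lemma coset_rel_trans : transitive coset_rel.
Proof.
move=> y x z /asboolP xy /asboolP yz; apply/asboolP.
by rewrite -(mulVKg y z) mulgA; apply: subgroupM; rewrite // mulgA.
Qed.

Canonical coset_equiv :=
  EquivRel coset_rel coset_rel_refl coset_rel_sym coset_rel_trans.

Definition quotient_type := {eq_quot coset_equiv}%qT.
HB.instance Definition _ := Choice.on quotient_type.

Definition coset_pi (x : G) : quotient_type :=
  (\pi_({eq_quot coset_equiv}) x)%qT.
Definition coset_repr (u : quotient_type) : G := repr u.

Lemma coset_reprK : cancel coset_repr coset_pi.
Proof. exact: reprK. Qed.

Lemma coset_piP x y : coset_pi x = coset_pi y <-> N (x^-1 * y).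
Proof.
have eqP := @eqquotP _ coset_equiv {eq_quot coset_equiv}%qT x y.
by split=> [/eqP/asboolP //|xy]; apply/eqP/asboolP.
Qed.

Definition quotient_mul u v := coset_pi (coset_repr u * coset_repr v).
Definition quotient_inv u := coset_pi (coset_repr u)^-1.

Lemma coset_piM x y : coset_pi (x * y) = quotient_mul (coset_pi x) (coset_pi y).
Proof.
have rE z : N (z^-1 * coset_repr (coset_pi z)).
  by apply/coset_piP; rewrite coset_reprK.
apply/coset_piP; set x' := coset_repr _; set y' := coset_repr _.
have -> : (x * y)^-1 * (x' * y') = (x^-1 * x') ^ y * (y^-1 * y').
  by rewrite conjgE invgM !mulgA mulgK.
by apply: subgroupM => //; apply: NJ; apply: rE.
Qed.

Lemma quotient_mulA : associative quotient_mul.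
Proof.
move=> u v w; rewrite -(coset_reprK u) -(coset_reprK v) -(coset_reprK w).
by rewrite -!coset_piM mulgA.
Qed.

Lemma quotient_mul1g : left_id (coset_pi 1) quotient_mul.
Proof. by move=> u; rewrite -(coset_reprK u) -coset_piM mul1g. Qed.

Lemma quotient_mulg1 : right_id (coset_pi 1) quotient_mul.
Proof. by move=> u; rewrite -(coset_reprK u) -coset_piM mulg1. Qed.

Lemma quotient_mulVg : left_inverse (coset_pi 1) quotient_inv quotient_mul.
Proof.
by move=> u; rewrite -{2}(coset_reprK u) -coset_piM mulVg.
Qed.

Lemma quotient_mulgV : right_inverse (coset_pi 1) quotient_inv quotient_mul.
Proof. by move=> u; rewrite -{1}(coset_reprK u) -coset_piM mulgV. Qed.

HB.instance Definition _ := isGroup.Build quotient_type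
  quotient_mulA quotient_mul1g quotient_mulg1 quotient_mulVg quotient_mulgV.

Lemma quotient_projection :
  exists (Q : groupType) (p : {multiplicative G -> Q}),
    range p = [set: Q] /\ forall x, p x = 1 <-> N x.
Proof.
have [p pE] := @multiplicativeP G quotient_type coset_pi coset_piM.
exists quotient_type, p; split.
  apply/seteqP; split=> // u _.
  by exists (coset_repr u); rewrite ?pE ?coset_reprK.
move=> x; rewrite pE; have -> : N x = N (1^-1 * x) by rewrite invg1 mul1g.
by rewrite -coset_piP; split=> [->|<-].
Qed.

End QuotientType.

(** * Reduction to finitely generated integrals *)

(** The subgroups B' with B finitely generated form a directed family, so their
    union is a subgroup; it contains all commutators. *)
Lemma derived_fg (G : groupType) (x : G) : derived G x ->
  exists B : seq G, generated (commutators (generated [set` B])) x.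
Proof.
pose D := [set y : G | exists B : seq G,
                         generated (commutators (generated [set` B])) y].
have mono (B C : seq G) : {subset B <= C} ->
    generated (commutators (generated [set` B]))
      `<=` generated (commutators (generated [set` C])).
  move=> BC; apply: generatedS; apply: commutatorsS; apply: generatedS.
  by move=> y; apply: BC.
rewrite derivedE; apply: (@generated_sub _ _ D).
  apply/is_subgroupP; split.
    by exists [::]; apply: subgroup1 (is_subgroup_generated _).
  move=> y z [B By] [C Cz]; exists (B ++ C).
  apply: (subgroupF (is_subgroup_generated _)).
    by apply: mono By => w; rewrite mem_cat => ->.
  by apply: mono Cz => w; rewrite mem_cat orbC => ->.
move=> _ [[y z] _ <-]; exists [:: y; z]; apply: sub_generated.
by exists (y, z) => //; split; apply: sub_generated; rewrite /= !inE eqxx ?orbT.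
Qed.

Lemma derived_fg_seq (G : groupType) (s : seq G) :
  [set` s] `<=` derived G ->
  exists B : seq G, [set` s] `<=` generated (commutators (generated [set` B])).
Proof.
elim: s => [_|a s IHs das]; first by exists [::].
have [|B sB] := IHs; first by move=> x xs; apply: das; rewrite /= inE xs orbT.
have [|C aC] := @derived_fg G a; first by apply: das; rewrite /= inE eqxx.
exists (C ++ B) => x; rewrite /= inE => /predU1P[->|/sB].
  move: aC; apply: generatedS; apply: commutatorsS; apply: generatedS.
  by move=> w /= wC; rewrite mem_cat wC.
apply: generatedS; apply: commutatorsS; apply: generatedS.
by move=> w /= wB; rewrite mem_cat wB orbT.
Qed.

Lemma fgP (G : groupType) :
  finitely_generated G <-> exists s : seq G, generated [set` s] = [set: G].
Proof.
split=> [[A /finite_seqP[s ->] sG]|[s sG]]; first by exists s.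
by exists [set` s].
Qed.

(** The group B' for a suitable finitely generated B contains the finitely many
    generators of H', and it is contained in H'. *)
Lemma fg_integral (G : groupType) : finitely_generated G -> integrable G ->
  exists2 H : groupType, finitely_generated H & integral G H.
Proof.
move=> /fgP[s sG] [H /iso_subgroupP[f [fI fG]]].
have dE : generated [set` map f s] = derived H.
  rewrite -fG -sG image_generated; congr generated.
  apply/seteqP; split=> x /=; first by move=> /mapP[y ys ->]; exists y.
  by move=> [y ys <-]; apply: map_f.
have [|B sB] := @derived_fg_seq H (map f s).
  by rewrite -dE; apply: sub_generated.
have [K [i [iI iK]]] := subgroup_inclusion (@is_subgroup_generated _ [set` B]).
have dK : i @` derived K = derived H.
  rewrite image_derived iK; apply/seteqP; split.
    by rewrite derivedE; apply: generatedS; apply: commutatorsS.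
  by rewrite -dE; apply: generated_sub sB; apply: is_subgroup_generated.
have [|g gE] := @factor_through_injection G H K i f iI.
  by rewrite fG -dK => _ [x _ <-]; exists x.
exists K; last first.
  apply/iso_subgroupP; exists g; split=> [x y gxy|].
    by apply: fI; rewrite -!gE gxy.
  apply: (injective_image iI); rewrite dK -fG image_comp.
  by congr image; apply/funext => x /=.
exists (i @^-1` [set` B]).
  by apply: finite_preimage; [move=> x y _ _; apply: iI | apply: finite_seq].
apply: (injective_image iI); rewrite image_generated iK; congr generated.
apply/seteqP; split=> [_ [x Bx <-] //|x Bx].
have [y _ yx] : range i x by rewrite iK; apply: sub_generated.
by exists y; rewrite //= yx.
Qed.

(** * The chain of cyclic extensions above the derived group *)

(** A subgroup that contains the derived group is normal, so the generators can
    be adjoined one after the other.  The induction runs over the sublists of s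
    and keeps the hypothesis that the adjoined element is one of the given
    generators, since these may be known to be torsion. *)
Lemma derived_ind (G : groupType) (s : seq G) (P : set G -> Prop) :
    generated [set` s] = [set: G] -> P (derived G) ->
    (forall g N, g \in s -> is_normal N [set: G] -> P N -> P (adjoin g N)) ->
  P [set: G].
Proof.
move=> sG Pd Padj.
have adj_seq (t : seq G) : {subset t <= s} ->
    exists N, [/\ is_subgroup N, derived G `<=` N, [set` t] `<=` N & P N].
  elim: t => [_|a t IHt ts].
    by exists (derived G); split=> //; apply: is_subgroup_derived.
  have [|N [sN dN tN PN]] := IHt.
    by move=> x xt; rewrite ts ?inE ?xt ?orbT.
  have nN := normal_derived_sub sN dN.
  exists (adjoin a N); split.
  - exact: is_subgroup_adjoin.
  - by move=> x /dN; apply: sub_adjoin.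
  - move=> x; rewrite /= inE => /predU1P[->|/tN]; first exact: mem_adjoin.
    exact: sub_adjoin.
  - by apply: Padj => //; rewrite ts ?mem_head.
have [//|N [sN _ gN PN]] := adj_seq s.
suff -> : [set: G] = N by [].
by apply/seteqP; split=> // x _; apply: (generated_sub sN gN); rewrite sG.
Qed.

Lemma fg_cyclic_extension_ind (H : groupType) (P : set H -> Prop) :
    finitely_generated H -> P (derived H) ->
    (forall N K, is_normal N K -> cyclic_quotient K N -> P N -> P K) ->
  P [set: H].
Proof.
move=> /fgP[s sG] Pd PK; apply: (derived_ind sG) => // g N _ nN PN.
by exact: PK (normal_in_adjoin g nN) (cyclic_quotient_adjoin g nN) PN.
Qed.

(** * The maximal condition *)

Section MaximalCondition.
Variable G : groupType.
Implicit Types (K N : set G).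

Definition max_on K : Prop :=
  forall F : set (set G), (forall S, F S -> is_subgroup S /\ S `<=` K) ->
    F !=set0 -> exists2 M, F M & forall S, F S -> M `<=` S -> S = M.

Lemma max_onT : max_on [set: G] <-> satisfies_Max G.
Proof.
split=> maxG F Fs; apply: maxG; first by move=> S /Fs.
by move=> S /Fs[].
Qed.

Lemma max_on1 : max_on [set 1].
Proof.
have sub1 (S : set G) : is_subgroup S -> S `<=` [set 1] -> S = [set 1].
  move=> sS S1; apply/seteqP; split=> // _ ->; exact: subgroup1.
move=> F Fs [S FS]; exists S => // T FT _.
have [[sS S1] [sT T1]] := (Fs _ FS, Fs _ FT).
by rewrite (sub1 T sT T1) (sub1 S sS S1).
Qed.

Lemma is_subgroupI K N :
  is_subgroup K -> is_subgroup N -> is_subgroup (K `&` N).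
Proof.
move=> sK sN; apply/is_subgroupP; split; first by split; apply: subgroup1.
by move=> x y [Kx Nx] [Ky Ny]; split; apply: subgroupF.
Qed.

(** Let g N generate K / N.  Among the members S of the family, first maximize
    S `&` N, then minimize the least positive d such that S meets g^d N (if no
    S meets any of these cosets, take any S).  If T in the family contains such
    an S, then T meets N where S does, and the positive exponents n for which T
    meets g^n N are not below d; division by an element of S in g^d N moves an
    element of T in g^n N into g^(n - d) N.  Hence T = S. *)
Lemma max_on_cyclic_extension N K :
  is_normal N K -> cyclic_quotient K N -> max_on N -> max_on K.
Proof.
move=> [sN sK NK NJ] /(cyclic_quotientP sN)[g Kg KgN] maxN F Fs [S0' FS0'].
have [||M0 [S0 FS0 <-] M0max] := maxN [set S `&` N | S in F].
- by move=> _ [S /Fs[sS SK] <-]; split; [apply: is_subgroupI | move=> x []].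
- by exists (S0' `&` N), S0'.
pose F0 S := F S /\ S `&` N = S0 `&` N.
have upF0 S T : F0 S -> F T -> S `<=` T -> F0 T.
  move=> [FS SN] FT ST; split=> //; apply: M0max; first by exists T.
  by rewrite -SN => x [/ST].
pose hit d := exists S y, [/\ F0 S, N y, S (g ^+ d * y) & (0 < d)%N].
have [S1 [F0S1 S1hit]] : exists S1, F0 S1 /\ forall n, hit n ->
    exists d y, [/\ (0 < d <= n)%N, N y & S1 (g ^+ d * y)].
  have [hd|nohit] := pselect (exists d, hit d); last first.
    by exists S0; split=> // n hn; case: nohit; exists n.
  have [|d /asboolP[S1 [y [F0S1 Ny S1y d_gt0]]] dmin] :=
      @ex_minnP (fun d => `[< hit d >]).
    by have [d hd'] := hd; exists d; apply/asboolP.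
  exists S1; split=> // n /asboolP/dmin dn.
  by exists d, y; split=> //; rewrite d_gt0.
exists S1; first by case: F0S1.
move=> T FT S1T; have F0T := upF0 _ _ F0S1 FT S1T.
have [sS1 _] := Fs _ F0S1.1; have [sT TK] := Fs _ FT.
have TN_S1 x : T x -> N x -> S1 x.
  move=> Tx Nx; have : (T `&` N) x by [].
  by rewrite F0T.2 -F0S1.2 => -[].
have pos n y : N y -> T (g ^+ n * y) -> S1 (g ^+ n * y).
  elim/ltn_ind: n y => -[|n] IHn y Ny.
    by rewrite mul1g => Ty; apply: TN_S1.
  move=> Ty; have [|d [z [/andP[d_gt0 le_dn] Nz S1z]]] := S1hit n.+1.
    by exists T, y.
  have zyE : (g ^+ d * z)^-1 * (g ^+ n.+1 * y)
           = g ^+ (n.+1 - d) * (z^-1 ^ (g ^+ (n.+1 - d)) * y).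
    rewrite [RHS]mulgA -conjgC -{1}(subnKC le_dn) expgnDr.
    by rewrite invgM !mulgA mulgVK.
  rewrite -(mulVKg (g ^+ d * z) (g ^+ n.+1 * y)).
  apply: subgroupM => //; rewrite zyE; apply: IHn.
  - by rewrite ltn_subrL d_gt0.
  - apply: subgroupM => //; apply: NJ; first exact: subgroupV.
    exact: subgroupX.
  - rewrite -zyE; apply: subgroupM => //; apply: subgroupV => //; exact: S1T.
apply/seteqP; split=> // t Tt.
(* The inverse of an element of g^-n N lies in g^n N, as N is normal. *)
have [[n|n] _ [y Ny tE]] := KgN _ (TK _ Tt); rewrite -tE in Tt *.
  exact: pos.
have yN : N (y^-1 ^ (g ^+ n.+1)).
  by apply: NJ; [exact: subgroupV | exact: subgroupX].
rewrite -[_ * y]invgK; apply: subgroupV => //.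
have E : (g ^- n.+1 * y)^-1 = g ^+ n.+1 * (y^-1 ^ (g ^+ n.+1)).
  by rewrite invgM invgK conjgC.
by rewrite E; apply: pos => //; rewrite -E; apply: subgroupV.
Qed.

End MaximalCondition.

Lemma max_on_image (G H : groupType) (f : {multiplicative G -> H}) :
  satisfies_Max G -> max_on (range f).
Proof.
move=> maxG F Fs [S0 FS0].
have fK S : F S -> f @` (f @^-1` S) = S.
  move=> /Fs[_ Sf]; apply/seteqP; split; first exact: image_preimage_subset.
  by move=> y Sy; have [x _ xy] := Sf _ Sy; exists x; rewrite //= xy.
have [||_ [S FS <-] Smax] := maxG [set f @^-1` S | S in F].
- by move=> _ [S /Fs[sS _] <-]; apply: is_subgroup_preimage.
- by exists (f @^-1` S0), S0.
exists S => // T FT ST; rewrite -(fK _ FT) -(fK _ FS); congr image.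
by apply: Smax; [exists T | move=> x /ST].
Qed.

(** A maximal finitely generated subgroup is the whole group. *)
Lemma Max_fg (G : groupType) : satisfies_Max G -> finitely_generated G.
Proof.
move=> maxG.
have [||_ [s _ <-] smax] :=
  maxG [set generated [set` s] | s in [set: seq G]].
- by move=> _ [s _ <-]; apply: is_subgroup_generated.
- by exists (generated [set` [::]]), [::].
apply/fgP; exists s; apply/seteqP; split=> // x _.
rewrite -(smax (generated [set` x :: s])); last 2 first.
- by exists (x :: s).
- by apply: generatedS => y /= ys; rewrite inE ys orbT.
by apply: sub_generated; rewrite /= mem_head.
Qed.

(** * Polycyclic groups *)

Section Polycyclic.
Variable G : groupType.
Implicit Types (K N : set G).

Definition polycyclic_on L : Prop :=
  exists (n : nat) (K : nat -> set G),
    [/\ K 0%N = [set 1], K n = L &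
        forall i, (i < n)%N ->
          is_normal (K i) (K i.+1) /\ cyclic_quotient (K i.+1) (K i)].

Lemma polycyclic_on_cyclic_extension N K :
  is_normal N K -> cyclic_quotient K N -> polycyclic_on N -> polycyclic_on K.
Proof.
move=> nNK cKN [n [L [L0 Ln Lstep]]].
exists n.+1, (fun i => if (i <= n)%N then L i else K); split=> //.
  by rewrite ltnn.
move=> i; rewrite ltnS => le_in; have [lt_in|le_ni] := ltnP i n.
  by rewrite (ltnW lt_in); apply: Lstep.
have -> : i = n by apply/eqP; rewrite eqn_leq le_in.
by rewrite leqnn Ln.
Qed.

Lemma polycyclic_on_max L : polycyclic_on L -> max_on L.
Proof.
move=> [n [K [K0 Kn Kstep]]]; rewrite -Kn.
have : (n <= n)%N by []; elim: {-2}n => [_|i IHi lt_in].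
  by rewrite K0; apply: max_on1.
have [nK cK] := Kstep _ lt_in; apply: max_on_cyclic_extension nK cK _.
exact/IHi/ltnW.
Qed.
End Polycyclic.

Lemma polycyclic_on_image (G H : groupType) (f : {multiplicative G -> H}) :
  polycyclic G -> polycyclic_on (range f).
Proof.
move=> [n [K [K0 Kn Kstep]]]; exists n, (fun i => f @` K i); split.
- by rewrite K0 image_set1 hom1.
- by rewrite Kn.
move=> i /Kstep[[sN sK NK NJ] [g Kg gK]]; split.
  split; [exact: is_subgroup_image | exact: is_subgroup_image
         | exact: image_subset |].
  move=> _ _ [x Nx <-] [y Ky <-]; exists (x ^ y); first exact: NJ.
  by rewrite homJ.
have fcoset x : left_coset (f x) (f @` K i) = f @` left_coset x (K i).
  rewrite /left_coset !image_comp; apply/seteqP.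
  by split=> _ [y Ny <-]; exists y; rewrite //= gmulfM.
exists (f g); first by exists g.
move=> _ [x /gK[m xm] <-]; exists m.
by rewrite -hom_expgz !fcoset xm.
Qed.

(** * Finite sets *)

Lemma pigeonhole (T : Type) (A : set T) (u : nat -> T) :
  finite_set A -> (forall i, A (u i)) -> exists i j, (i < j)%N /\ u i = u j.
Proof.
move=> finA uA; apply: contrapT => noij; apply: infinite_nat.
have -> : [set: nat] = u @^-1` A by apply/seteqP; split=> // i _; apply: uA.
apply: finite_preimage => // i j _ _ uij.
have [lt_ij|lt_ji|//] := ltngtP i j; case: noij; first by exists i, j.
by exists j, i.
Qed.

Lemma finite_range_factor (S T U : Type) (c : S -> T) (h : S -> U) :
  finite_set (range c) -> (forall x y, c x = c y -> h x = h y) ->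
  finite_set (range h).
Proof.
move=> finc ch; have [->|/set0P[z _]] := eqVneq [set: S] set0.
  by rewrite image_set0.
have /choice[r rE] t : exists x, range c t -> c x = t.
  have [[x _ <-]|nct] := pselect (range c t); first by exists x.
  by exists z => /nct.
apply: sub_finite_set (finite_image (h \o r) finc) => _ [x _ <-].
by exists (c x); [exists x | apply/ch/rE; exists x].
Qed.

Lemma finite_seqs (T : Type) n :
  finite_set [set: T] -> finite_set [set t : seq T | size t = n].
Proof.
move=> finT; elim: n => [|n IHn].
  by apply: sub_finite_set (finite_set1 [::]) => -[].
apply: sub_finite_set (finite_image2 cons finT IHn) => -[//|x t] /= [tn].
by exists x => //; exists t.
Qed.

(** * Groups with a finite derived group *)

(** At each step of the chain above the derived group, the adjoined generator
    contributes finitely many powers. *)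
Lemma finite_group_of_torsion (G : groupType) (s : seq G) :
    generated [set` s] = [set: G] ->
    (forall a, a \in s -> exists2 k, (0 < k)%N & a ^+ k = 1) ->
  finite_set (derived G) -> finite_group G.
Proof.
move=> sG tor fin_d; apply: (derived_ind sG) => // g N /tor[k k_gt0 gk1] _ finN.
(* The inverse of g is g ^+ k.-1, so natural exponents suffice. *)
have pow m : exists j, expgz g m = g ^+ j.
  case: m => n; first by exists n.
  exists (k.-1 * n.+1)%N; rewrite /= expgnA -expVgn; congr (_ ^+ _).
  by apply/mulg1_eq; rewrite -expgS prednK.
apply: sub_finite_set (finite_image2 *%g (finite_image _ (finite_II k)) finN).
move=> _ [m _ [y Ny <-]]; have [j ->] := pow m.
exists (g ^+ (j %% k)); first by exists (j %% k)%N => //=; rewrite ltn_mod.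
exists y => //; rewrite {2}(divn_eq j k) expgnDr mulnC expgnA gk1.
by rewrite expg1n mul1g.
Qed.

Lemma torsion_finite (G : groupType) (K : set G) x :
  is_subgroup K -> finite_set K -> K x -> exists2 n, (0 < n)%N & x ^+ n = 1.
Proof.
move=> sK finK Kx; have [|i [j [lt_ij xij]]] := @pigeonhole _ K (natexp x) finK.
  by move=> i; apply: subgroupX.
exists (j - i)%N; first by rewrite subn_gt0.
by rewrite expgnFr ?xij ?mulgV // ltnW.
Qed.

(** Two of the commutators [~ b, a ^+ i] agree; then so do the conjugates of b
    by the two powers of a. *)
Lemma commuting_power (G : groupType) (a b : G) : finite_set (derived G) ->
  exists2 k, (0 < k)%N & commute b (a ^+ k).
Proof.
move=> fin_d.
have [|i [j [lt_ij]]] := @pigeonhole _ _ (fun i => [~ b, a ^+ i]) fin_d.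
  by move=> i; apply: derivedR.
rewrite !commgEl => /mulgI; rewrite -(subnK (ltnW lt_ij)) expgnDr conjgM.
move=> /conjg_inj bE; exists (j - i)%N; first by rewrite subn_gt0.
by apply/commgP/conjg_fixP.
Qed.

(** The product of exponents that serve for the single generators serves for
    all of them. *)
Lemma central_power (G : groupType) (a : G) :
    finitely_generated G -> finite_set (derived G) ->
  exists2 m, (0 < m)%N & forall x, commute (a ^+ m) x.
Proof.
move=> /fgP[s sG] fin_d.
have [m m_gt0 am] : exists2 m, (0 < m)%N &
    forall b, b \in s -> commute (a ^+ m) b.
  elim: {sG} s => [|b s [m m_gt0 IHm]]; first by exists 1%N.
  have [k k_gt0 bk] := commuting_power a b fin_d.
  exists (m * k)%N; first by rewrite muln_gt0 m_gt0.
  move=> c; rewrite inE => /predU1P[->|/IHm mc].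
    by rewrite mulnC expgnA; apply/commute_sym/commuteX.
  by rewrite expgnA; apply/commute_sym/commuteX/commute_sym.
exists m => // x; have : [set: G] x by []; rewrite -sG.
exact: (generated_sub (is_subgroup_centralizer _)).
Qed.

(** Induction on s.  A generator a with no positive power in N has a central
    power c, which is adjoined to N.  If c^i z, with z in N, lies in the derived
    group, then it is torsion, so a multiple of i is the exponent of a power of
    c in N; hence i = 0, and the new subgroup meets the derived group where N
    does. *)
Lemma central_complement (G : groupType) (s : seq G) :
    finitely_generated G -> finite_set (derived G) ->
  exists N : set G, [/\ is_subgroup N, forall x y, N x -> commute x y,
    derived G `&` N `<=` [set 1] &
    forall a, a \in s -> exists2 k, (0 < k)%N & N (a ^+ k)].
Proof.
move=> fgG fin_d; elim: s => [|a s [N [sN cN dN sNk]]].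
  exists [set 1]; split; [exact: is_subgroup1 | | by move=> x [] | by []].
  by move=> _ y ->; apply/commute_sym/commute1.
have [[k k_gt0 Nak]|no_k] := pselect (exists2 k, (0 < k)%N & N (a ^+ k)).
  exists N; split=> // b; rewrite inE => /predU1P[->|/sNk //].
  by exists k.
have [m m_gt0 cm] := central_power a fgG fin_d.
have nN : is_normal N [set: G].
  split=> // [|x y Nx _]; first exact: is_subgroupT.
  by have /conjg_fixP-> // : [~ x, y] == 1 by apply/commgP/cN.
have cexp i y : commute (expgz (a ^+ m) i) y.
  exact/commute_sym/commute_expgz/commute_sym/cm.
exists (adjoin (a ^+ m) N); split.
- exact: is_subgroup_adjoin.
- move=> _ y [i _ [z Nz <-]]; apply/commute_sym/commuteM.
    exact/commute_sym/cexp.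
  exact/commute_sym/cN.
- move=> x [dx [i _ [z Nz xE]]]; move: dx; rewrite -{x}xE => dx.
  have [n n_gt0 xn] := torsion_finite (is_subgroup_derived _) fin_d dx.
  have i0 : i = 0%R.
    have : N (expgz (a ^+ m) i ^+ n).
      have -> : expgz (a ^+ m) i ^+ n = z ^- n.
        by apply: (mulIg (z ^+ n)); rewrite mulVg -expgMn.
      by apply: subgroupV => //; apply: subgroupX.
    have nopow j : ~ N (((a ^+ m) ^+ j.+1) ^+ n).
      rewrite -!expgnA => Nj; case: no_k; exists (m * (j.+1 * n))%N => //.
      by rewrite !muln_gt0 m_gt0.
    case: i {dx xn} => [[|j]|j] //= Nj; first by case: (nopow j).
    case: (nopow j); rewrite -[_ ^+ n]invgK -expVgn.
    exact: subgroupV.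
  by apply: dN; split; [|]; rewrite i0 mul1g in dx *.
- move=> b; rewrite inE => /predU1P[->|/sNk[k k_gt0 Nbk]].
    by exists m => //; apply: mem_adjoin.
  by exists k => //; apply: sub_adjoin.
Qed.

(** The quotient by the subgroup N of [central_complement] is generated by
    torsion elements. *)
Lemma finite_quotient_of_finite_derived (G : groupType) :
    finitely_generated G -> finite_set (derived G) ->
  exists (Q : groupType) (p : {multiplicative G -> Q}),
    [/\ finite_group Q, range p = [set: Q] &
        forall x, derived G x -> p x = 1 -> x = 1].
Proof.
move=> fgG fin_d; have [s sG] := (fgP G).1 fgG.
have [N [sN cN dN sNk]] := central_complement s fgG fin_d.
have nN : is_normal N [set: G].
  split=> // [|x y Nx _]; first exact: is_subgroupT.
  by have /conjg_fixP-> // : [~ x, y] == 1 by apply/commgP/cN.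
have [Q [p [pT pN]]] := quotient_projection nN.
exists Q, p; split=> //; last first.
  by move=> x dx px; apply: dN; split=> //; apply/pN.
apply: (@finite_group_of_torsion _ (map p s)).
- rewrite -pT -sG image_generated; congr generated.
  apply/seteqP; split=> x /=; first by move=> /mapP[y ys ->]; exists y.
  by move=> [y ys <-]; apply: map_f.
- move=> _ /mapP[a /sNk[k k_gt0 Nak] ->]; exists k => //.
  by rewrite -homX; apply/pN.
- by rewrite -(image_derived_surj pT); apply: finite_image.
Qed.

Lemma integral_quotient (G H Q : groupType) (p : {multiplicative H -> Q}) :
    integral G H -> range p = [set: Q] ->
    (forall x, derived H x -> p x = 1 -> x = 1) ->
  integral G Q.
Proof.
move=> /iso_subgroupP[f [fI fG]] pT pI; apply/iso_subgroupP.
exists (p \o f); split; last first.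
  by rewrite -(image_derived_surj pT) -fG image_comp.
apply: hom_inj => x pfx; apply: fI; rewrite hom1; apply: pI => //.
by rewrite -fG; exists x.
Qed.

(** * Residually finite groups *)

Lemma hom_eq_generated (G H : groupType) (A : set G)
    (f g : {multiplicative G -> H}) :
  generated A = [set: G] -> {in A, f =1 g} -> (f : G -> H) = g.
Proof.
move=> AG fgA; apply/funext => x; have : [set: G] x by []; rewrite -AG.
apply: (@generated_sub _ _ [set y | f y = g y]); last first.
  by move=> y Ay; apply/fgA/mem_set.
apply/is_subgroupP; split; first by rewrite /= !hom1.
by move=> y z /= fgy fgz; rewrite !homF fgy fgz.
Qed.

(** A homomorphism is determined by the list of its values at the generators. *)
Lemma finite_homs (G Q : groupType) :
  finitely_generated G -> finite_group Q ->
  finite_set (range (fun f : {multiplicative G -> Q} => f : G -> Q)).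
Proof.
move=> /fgP[s sG] finQ.
apply: (finite_range_factor (c := fun f : {multiplicative G -> Q} => map f s)).
  apply: sub_finite_set (finite_seqs (size s) finQ) => _ [f _ <-].
  exact: size_map.
move=> f g /eq_in_map fg; apply: hom_eq_generated sG _ => x.
by rewrite inE; apply: fg.
Qed.

(** When Q is finite and G is finitely generated, this is a characteristic
    subgroup of finite index. *)
Definition hom_residual (G Q : groupType) : set G :=
  [set x | forall f : {multiplicative G -> Q}, f x = 1].

(** The value p x is determined by the list of the values at x of the finitely
    many homomorphisms to Q. *)
Lemma finite_mod_hom_residual (G H Q : groupType)
    (p : {multiplicative G -> H}) :
    finitely_generated G -> finite_group Q ->
    (forall x, hom_residual Q x -> p x = 1) ->
  finite_set (range p).
Proof.
move=> fgG finQ pQ; have [L LE] := (finite_seqP _).1 (finite_homs fgG finQ).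
apply: (finite_range_factor (c := fun x => [seq f x | f <- L])).
  apply: sub_finite_set (finite_seqs (size L) finQ) => _ [f _ <-].
  exact: size_map.
move=> x y /eq_in_map xy; apply/divg1_eq; rewrite -homF; apply: pQ => f.
have fL : [set` L] (f : G -> Q) by rewrite -LE; exists f.
by rewrite homF (xy _ fL) mulgV.
Qed.

Definition finite_residual (G : groupType) : set G :=
  [set x | forall Q : groupType, finite_group Q -> hom_residual Q x].

Lemma normal_finite_residual (G : groupType) :
  is_normal (@finite_residual G) [set: G].
Proof.
split=> //; last 2 first.
- exact: is_subgroupT.
- by move=> x y Rx _ Q finQ f; rewrite homJ Rx // conj1g.
apply/is_subgroupP; split=> [Q _ f|x y Rx Ry Q finQ f]; first exact: hom1.
by rewrite homF Rx // Ry // mulgV.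
Qed.

(** A homomorphism from G to a finite group kills the finite residual, so it
    factors through the quotient and separates there what it separated in G. *)
Lemma residually_finite_quotient (G Q : groupType)
    (p : {multiplicative G -> Q}) :
    range p = [set: Q] -> (forall x, p x = 1 <-> finite_residual x) ->
  residually_finite Q.
Proof.
move=> pT pR y y1; have [x _ xy] : range p y by rewrite pT.
have : ~ finite_residual x by rewrite -pR xy.
move=> /existsNP[L] /not_implyP[finL] /existsNP[f fx].
have [|g gE] := @factor_through_surjection G Q L p f pT.
  by move=> z /pR Rz; apply: Rz.
by exists L, g; split=> //; rewrite -xy gE.
Qed.

(** Let g <> 1 in the derived group be separated from 1 by a homomorphism from
    it to Q.  Modulo the subgroup K of those elements of the derived group that
    all its homomorphisms to Q kill, the derived group is finite and g is still
    nontrivial; a finite quotient of H / K that is faithful on the derived group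
    separates g from 1. *)
Lemma derived_finite_residual (G H : groupType) (x : H) :
    finitely_generated G -> residually_finite G -> finitely_generated H ->
    integral G H ->
  derived H x -> finite_residual x -> x = 1.
Proof.
move=> fgG rfG fgH /iso_subgroupP[f [fI fG]].
rewrite -fG => -[g _ <-] Rx; apply: contrapT => fg1.
have [g1|Q [phi [finQ phig]]] := rfG g; first by rewrite g1 hom1 in fg1.
pose K := f @` hom_residual Q.
have nK : is_normal K [set: H].
  split=> //; [| exact: is_subgroupT |].
    apply: is_subgroup_image; apply/is_subgroupP.
    split=> [psi|u v Ku Kv psi]; first exact: hom1.
    by rewrite homF Ku Kv mulgV.
  move=> _ y [u Ku <-] _.
  (* Conjugation by y acts on the derived group, hence as an endomorphism alpha
     of G, and composing with alpha maps homomorphisms to homomorphisms. *)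
  have [|c cE] := @multiplicativeP G H (fun u => f u ^ y).
    by move=> v w; rewrite gmulfM conjMg.
  have [|alpha alphaE] := @factor_through_injection G H G f c fI.
    move=> _ [v _ <-]; rewrite fG cE.
    have [_ _ _ dJ] := normal_derived H.
    by apply: dJ => //; rewrite -fG; exists v.
  exists (alpha u); last by rewrite alphaE cE.
  by move=> psi; apply: (Ku (psi \o alpha)).
have [L [p [pT pK]]] := quotient_projection nK.
have fin_d : finite_set (derived L).
  rewrite -(image_derived_surj pT) -fG image_comp.
  apply: (@finite_mod_hom_residual _ _ Q (p \o f)) => // u Ku.
  by apply/pK; exists u.
have [F [q [finF _ qI]]] :=
  finite_quotient_of_finite_derived (fg_surj pT fgH) fin_d.
have /pK[u Ku /fI ug] : p (f g) = 1.
  apply: qI; last exact: (Rx F finF (q \o p)).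
  by rewrite -(image_derived_surj pT); exists (f g); rewrite // -fG;
     exists g.
by apply: phig; rewrite -ug.
Qed.

(** * The self-integrating classes *)

Lemma finite_fg (G : groupType) : finite_group G -> finitely_generated G.
Proof.
move=> finG; exists [set: G] => //; apply/seteqP; split=> // x _.
exact: sub_generated.
Qed.

Lemma self_integrating_finite : self_integrating finite_group.
Proof.
move=> G finG /(fg_integral (finite_fg finG))[H fgH GH].
have [|Q [p [finQ pT pI]]] := @finite_quotient_of_finite_derived H fgH.
  by have [f [_ <-]] := (iso_subgroupP _ _).1 GH; apply: finite_image.
by exists Q => //; apply: integral_quotient GH pT pI.
Qed.

Lemma self_integrating_fg : self_integrating finitely_generated.
Proof. exact: fg_integral. Qed.

Lemma polycyclic_Max (G : groupType) : polycyclic G -> satisfies_Max G.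
Proof. by move=> pG; apply/max_onT/polycyclic_on_max. Qed.

Lemma self_integrating_Max : self_integrating satisfies_Max.
Proof.
move=> G maxG /(fg_integral (Max_fg maxG))[H fgH GH].
exists H => //; apply/max_onT.
apply: (fg_cyclic_extension_ind (P := @max_on H)) => //.
  have [f [_ <-]] := (iso_subgroupP _ _).1 GH; exact: max_on_image.
exact: max_on_cyclic_extension.
Qed.

Lemma self_integrating_polycyclic : self_integrating polycyclic.
Proof.
move=> G pG /(fg_integral (Max_fg (polycyclic_Max pG)))[H fgH GH].
exists H => //.
apply: (fg_cyclic_extension_ind (P := @polycyclic_on H)) => //.
  have [f [_ <-]] := (iso_subgroupP _ _).1 GH; exact: polycyclic_on_image.
exact: polycyclic_on_cyclic_extension.
Qed.

Lemma self_integrating_fg_residually_finite :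
  self_integrating
    (fun G : groupType => finitely_generated G /\ residually_finite G).
Proof.
move=> G [fgG rfG] /(fg_integral fgG)[H fgH GH].
have [Q [p [pT pR]]] := quotient_projection (normal_finite_residual H).
exists Q.
  by split; [apply: fg_surj pT fgH | apply: residually_finite_quotient pT pR].
apply: (integral_quotient GH pT) => x dx /pR.
exact: derived_finite_residual GH dx.
Qed.

Theorem lemma7p1 :
  self_integrating finite_group /\
  self_integrating finitely_generated /\
  (self_integrating polycyclic /\ self_integrating satisfies_Max) /\
  self_integrating
    (fun G : groupType => finitely_generated G /\ residually_finite G).
Proof.
split; first exact: self_integrating_finite.
split; first exact: self_integrating_fg.
split; last exact: self_integrating_fg_residually_finite.
by split; [apply: self_integrating_polycyclic | apply: self_integrating_Max].
Qed.
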